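(* There exist universal constants $c>0$, $C'\ge0$ such that for any integer $d>1$ there exist two distributions $D$ and $P$ over $\mathbb{R}^d\times\{\pm1\}$ whose marginals $D_X,P_X$ have identical covariance matrices, such that for all $\epsilon,\delta\in(0,\frac14)$, $m(\epsilon,1,P,\delta)\ge c\,d-C'$ while $m(\epsilon,1,D,\delta)\le\lceil\log_2(1/\delta)\rceil$. Moreover, $D_X$ and $P_X$ are sub-Gaussian with relative moment $\sqrt2$ in all directions, i.e., for $X\sim D_X$ or $X\sim P_X$ and every $u\in\mathbb{R}^d$, $\langle u,X\rangle$ is sub-Gaussian with relative moment $\sqrt2$.
   Context: Hypothesis class $\mathcal{W}=\{x\mapsto\langle w,x\rangle\mid\|w\|\le1\}$. For $h$: $\ell_0(h,D)=\mathbb{P}_{(X,Y)\sim D}[Yh(X)\le0]$, $\ell_\gamma(h,D)=\mathbb{P}[Yh(X)\le\gamma]$, $\ell^*_\gamma(D)=\inf_{h\in\mathcal{W}}\ell_\gamma(h,D)$; for a labeled sample $S$ of size $n$, $\ell_\gamma(h,S)=\frac1n|\{i:y_ih(x_i)\le\gamma\}|$. A learning algorithm maps finite labeled samples to functions; $\ell_0(\mathcal{A},D,n,\delta)=\inf\{\epsilon\ge0\mid\mathbb{P}_{S\sim D^n}[\ell_0(\mathcal{A}(S),D)\ge\epsilon]\le\delta\}$. An MEM algorithm $\mathcal{A}$ maps each $\gamma>0$ to $\mathcal{A}_\gamma$ with $\mathcal{A}_\gamma(S)\in\arg\min_{h\in\mathcal{W}}\ell_\gamma(h,S)$. The sample complexity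 $m(\epsilon,\gamma,D,\delta)$ is the minimal $m_0$ such that for every MEM algorithm and every $n\ge m_0$, $\ell_0(\mathcal{A}_\gamma,D,n,\delta)-\ell^*_\gamma(D)\le\epsilon$. A real random variable $Z$ is sub-Gaussian with relative moment $\rho$ if $\mathbb{E}[\exp(tZ)]\le\exp(t^2\rho^2\mathbb{E}[Z^2]/2)$ for all $t\in\mathbb{R}$. *)

(* Defs.v *)
From Stdlib Require Import Reals Lra List Classical ClassicalEpsilon.
Open Scope R_scope.

(** Points of R^d are represented as functions [nat -> R]; only the
    coordinates [0..d-1] are ever used (all operations take [d]). *)
Definition point := nat -> R.

Definition fsum {A : Type} (f : A -> R) (l : list A) : R :=
  fold_right (fun a acc => f a + acc) 0 l.

Definition ind (P : Prop) : R :=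
  if excluded_middle_informative P then 1 else 0.

Definition inner (d : nat) (w x : point) : R :=
  fsum (fun i => w i * x i) (seq 0 d).
Definition norm (d : nat) (w : point) : R := sqrt (inner d w w).

(** Infimum of a set of reals (greatest lower bound); 0 if none exists. *)
Definition is_glb (E : R -> Prop) (m : R) : Prop :=
  (forall x, E x -> m <= x) /\ (forall b, (forall x, E x -> b <= x) -> b <= m).
Definition Rinf (E : R -> Prop) : R :=
  match excluded_middle_informative (exists m, is_glb E m) with
  | left H => proj1_sig (constructive_indefinite_description _ H)
  | right _ => 0
  end.

(** A finitely supported distribution over R^d x {+-1}: a list of atoms
    (x, y, p) with point x, label y and probability weight p. *)
Definition fdist := list (point * R * R).

Definition is_fdist (D : fdist) : Prop :=
  Forall (fun a => let '(x, y, p) := a in 0 <= p /\ (y = 1 \/ y = -1)) D /\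
  fsum (fun a => let '(x, y, p) := a in p) D = 1.

Definition sample := list (point * R).

Fixpoint expn (D : fdist) (n : nat) (f : sample -> R) : R :=
  match n with
  | O => f nil
  | S k => fsum (fun a => let '(x, y, p) := a in
                   p * expn D k (fun s => f ((x, y) :: s))) D
  end.

Definition probn (D : fdist) (n : nat) (E : sample -> Prop) : R :=
  expn D n (fun S => ind (E S)).

Definition lossD (gamma : R) (h : point -> R) (D : fdist) : R :=
  fsum (fun a => let '(x, y, p) := a in p * ind (y * h x <= gamma)) D.

Definition lossS (gamma : R) (h : point -> R) (S : sample) : R :=
  / INR (length S) *
  fsum (fun a => let '(x, y) := a in ind (y * h x <= gamma)) S.

Definition lstar (d : nat) (gamma : R) (D : fdist) : R :=
  Rinf (fun v => exists w, norm d w <= 1 /\ v = lossD gamma (inner d w) D).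

Definition is_MEM (d : nat) (A : R -> sample -> point) : Prop :=
  forall gamma S, 0 < gamma ->
    norm d (A gamma S) <= 1 /\
    forall w, norm d w <= 1 ->
      lossS gamma (inner d (A gamma S)) S <= lossS gamma (inner d w) S.

Definition l0A (d : nat) (Ag : sample -> point) (D : fdist) (n : nat) (delta : R) : R :=
  Rinf (fun eps => 0 <= eps /\
        probn D n (fun S => lossD 0 (inner d (Ag S)) D >= eps) <= delta).

(** [sc_ok d eps gamma D delta m0]: m0 is an admissible value in the definition
    of the sample complexity, i.e. for every MEM algorithm and every n >= m0,
    l_0(A_gamma, D, n, delta) - l*_gamma(D) <= eps.  The sample complexity
    m(eps,gamma,D,delta) is the least such m0 (infinite if none). *)
Definition sc_ok (d : nat) (eps gamma : R) (D : fdist) (delta : R) (m0 : nat) : Prop :=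
  forall A, is_MEM d A -> forall n, (m0 <= n)%nat ->
    l0A d (A gamma) D n delta - lstar d gamma D <= eps.

(** m(eps,gamma,D,delta) >= b  (as a value in N u {oo}). *)
Definition sample_complexity_ge (d : nat) (eps gamma : R) (D : fdist) (delta b : R) : Prop :=
  forall m0, sc_ok d eps gamma D delta m0 -> b <= INR m0.

Definition sample_complexity_le (d : nat) (eps gamma : R) (D : fdist) (delta b : R) : Prop :=
  exists m0, sc_ok d eps gamma D delta m0 /\ INR m0 <= b.

Definition expectX (D : fdist) (f : point -> R) : R :=
  fsum (fun a => let '(x, y, p) := a in p * f x) D.
Definition cov (D : fdist) (i j : nat) : R :=
  expectX D (fun x => x i * x j) - expectX D (fun x => x i) * expectX D (fun x => x j).

Definition subgaussian_rel (D : fdist) (f : point -> R) (rho : R) : Prop :=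
  forall t, expectX D (fun x => exp (t * f x)) <=
            exp (t ^ 2 * rho ^ 2 * expectX D (fun x => (f x) ^ 2) / 2).

Definition Rceil (x : R) : Z := (- Int_part (- x))%Z.
Definition log2 (x : R) : R := ln x / ln 2.

(* Main.v *)
Require Import Defs.
From Stdlib Require Import Reals List.
From Stdlib Require Import ZArith Arith Lra Lia Classical ClassicalEpsilon.
From Coquelicot Require Import Coquelicot.
(* Imported again because [Reals] and [Coquelicot] shadow [ind] and [norm]. *)
Require Import Defs.
Import ListNotations.
Open Scope R_scope.

(** Both marginals are built from cubes with vertices [(±a, ±s, ..., ±s)] labelled by the
    sign of the first coordinate, so that the first axis separates with margin [a > 1].
    [P] is uniform on one cube. By Odlyzko's argument, [d - 2] uniform sign vectors remain
    linearly independent after deleting the first coordinate with probability at least 1/2;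
    some [w] with zero first coordinate then fits all labels, and its norm is at most 1 once
    [s] is large. Its predictions are independent of the label, so its error is at least 1/2.
    [D] is an equal mixture of a flat cube ([s = 0]) and a cube with [s] enlarged by [sqrt 2],
    which gives the covariance of [P]. One flat example forces [w 0 * a > 1]; for [a] close
    enough to 1 this leaves [w] too little norm on the other axes to err anywhere. All [n]
    examples miss the flat cube with probability [2^-n]. *)

(** * Finite sums over lists *)

Section Fsum.
Context {A : Type}.
Implicit Types (f g : A -> R) (l : list A).

Lemma fsum_app f l1 l2 : fsum f (l1 ++ l2) = fsum f l1 + fsum f l2.
Proof. induction l1 as [|a l1 IH]; simpl; [|rewrite IH]; lra. Qed.

Lemma fsum_map {B : Type} (h : B -> A) f (l : list B) :
  fsum f (map h l) = fsum (fun b => f (h b)) l.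
Proof. induction l as [|b l IH]; simpl; [|rewrite IH]; reflexivity. Qed.

Lemma fsum_ext f g l : (forall a, In a l -> f a = g a) -> fsum f l = fsum g l.
Proof.
  induction l as [|a l IH]; simpl; intros H; [reflexivity|].
  rewrite H, IH by auto. reflexivity.
Qed.

Lemma fsum_le f g l : (forall a, In a l -> f a <= g a) -> fsum f l <= fsum g l.
Proof.
  induction l as [|a l IH]; simpl; intros H; [lra|].
  apply Rplus_le_compat; auto.
Qed.

Lemma fsum_plus f g l : fsum (fun a => f a + g a) l = fsum f l + fsum g l.
Proof. induction l as [|a l IH]; simpl; [|rewrite IH]; lra. Qed.

Lemma fsum_scal c f l : fsum (fun a => c * f a) l = c * fsum f l.
Proof. induction l as [|a l IH]; simpl; [|rewrite IH]; lra. Qed.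

Lemma fsum_const c l : fsum (fun _ => c) l = INR (length l) * c.
Proof.
  induction l as [|a l IH]; [simpl; lra|].
  cbn [fsum fold_right length]. unfold fsum in IH. rewrite IH, S_INR. lra.
Qed.

Lemma fsum_zero f l : (forall a, In a l -> f a = 0) -> fsum f l = 0.
Proof.
  intros H. rewrite (fsum_ext f (fun _ => 0)) by exact H. rewrite fsum_const. lra.
Qed.

Lemma fsum_nonneg f l : (forall a, In a l -> 0 <= f a) -> 0 <= fsum f l.
Proof.
  intros H. rewrite <- (fsum_zero (fun _ => 0) l) by reflexivity. apply fsum_le, H.
Qed.

Lemma fsum_elem_le f l a :
  (forall a, In a l -> 0 <= f a) -> In a l -> f a <= fsum f l.
Proof.
  induction l as [|b l IH]; simpl; intros H Ha; [easy|].
  assert (0 <= fsum f l) by (apply fsum_nonneg; auto).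
  assert (0 <= f b) by auto.
  destruct Ha as [->|Ha]; [unfold fsum in *; lra|].
  assert (f a <= fsum f l) by auto. unfold fsum in *; lra.
Qed.

Lemma fsum_abs_le f l : Rabs (fsum f l) <= fsum (fun a => Rabs (f a)) l.
Proof.
  induction l as [|a l IH]; simpl; [rewrite Rabs_R0; lra|].
  eapply Rle_trans; [apply Rabs_triang|]. apply Rplus_le_compat_l, IH.
Qed.

End Fsum.

(** * Indicators and infima *)

Lemma ind_true (Q : Prop) : Q -> ind Q = 1.
Proof. unfold ind; destruct excluded_middle_informative; tauto. Qed.

Lemma ind_false (Q : Prop) : ~ Q -> ind Q = 0.
Proof. unfold ind; destruct excluded_middle_informative; tauto. Qed.

Lemma ind_bounds (Q : Prop) : 0 <= ind Q <= 1.
Proof. unfold ind; destruct excluded_middle_informative; lra. Qed.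

Lemma ind_le (Q Q' : Prop) : (Q -> Q') -> ind Q <= ind Q'.
Proof. unfold ind; do 2 destruct excluded_middle_informative; intros; try lra; tauto. Qed.

Lemma fsum_ind {A : Type} (Q : A -> Prop) (l : list A) :
  fsum (fun a => ind (Q a)) l =
  INR (length (filter (fun a => if excluded_middle_informative (Q a) then true else false) l)).
Proof.
  induction l as [|a l IH]; [reflexivity|].
  cbn [fsum fold_right filter]. unfold fsum in IH; rewrite IH. unfold ind.
  destruct excluded_middle_informative; [cbn [length]; rewrite S_INR|]; lra.
Qed.

(** Nonemptiness and a lower bound rule out the default value 0 of [Rinf]: completeness, applied to
    the reflected set, supplies the greatest lower bound. *)
Lemma Rinf_glb (E : R -> Prop) (m : R) :
  (exists x, E x) -> (forall x, E x -> m <= x) -> is_glb E (Rinf E).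
Proof.
  intros [x Hx] Hm. unfold Rinf.
  destruct excluded_middle_informative as [H|H].
  - apply (proj2_sig (constructive_indefinite_description _ H)).
  - exfalso; apply H.
    destruct (completeness (fun y => E (- y))) as [s [Hs1 Hs2]].
    + exists (- m). intros y Hy. apply Hm in Hy. lra.
    + exists (- x). rewrite Ropp_involutive. exact Hx.
    + exists (- s). split.
      * intros y Hy. assert (- y <= s); [|lra].
        apply Hs1. rewrite Ropp_involutive. exact Hy.
      * intros b Hb. assert (s <= - b); [|lra].
        apply Hs2. intros y Hy. apply Hb in Hy. lra.
Qed.

Lemma Rinf_le (E : R -> Prop) (m x : R) :
  (forall x, E x -> m <= x) -> E x -> Rinf E <= x.
Proof. intros Hm Hx. apply (Rinf_glb E m); eauto. Qed.

Lemma Rinf_ge (E : R -> Prop) (m : R) :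
  (exists x, E x) -> (forall x, E x -> m <= x) -> m <= Rinf E.
Proof. intros Hx Hm. apply (Rinf_glb E m); eauto. Qed.

(** * Inner product and norm *)

Section Inner.
Variable d : nat.

Lemma inner_plus v w x : inner d (fun j => v j + w j) x = inner d v x + inner d w x.
Proof.
  unfold inner. rewrite <- fsum_plus. apply fsum_ext. intros; lra.
Qed.

Lemma inner_scal c w x : inner d (fun j => c * w j) x = c * inner d w x.
Proof.
  unfold inner. rewrite <- fsum_scal. apply fsum_ext. intros; lra.
Qed.

Lemma inner_delta j x :
  (j < d)%nat -> inner d (fun i => if Nat.eq_dec i j then 1 else 0) x = x j.
Proof.
  intros Hj. unfold inner.
  replace (seq 0 d) with (seq 0 j ++ j :: seq (S j) (d - S j)).
  2:{ rewrite cons_seq, <- seq_app. f_equal. lia. }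
  rewrite fsum_app. cbn [fsum fold_right].
  rewrite fsum_zero.
  2:{ intros i Hi. apply in_seq in Hi. destruct Nat.eq_dec; [lia|lra]. }
  change (0 + ((if Nat.eq_dec j j then 1 else 0) * x j +
    fsum (fun i => (if Nat.eq_dec i j then 1 else 0) * x i) (seq (S j) (d - S j))) = x j).
  rewrite fsum_zero.
  2:{ intros i Hi. apply in_seq in Hi. destruct Nat.eq_dec; [lia|lra]. }
  destruct Nat.eq_dec; [lra|easy].
Qed.

Lemma norm_scal c w : 0 <= c -> norm d (fun j => c * w j) = c * norm d w.
Proof.
  intros Hc. unfold norm.
  replace (inner d (fun j => c * w j) (fun j => c * w j)) with (c * c * inner d w w).
  - rewrite sqrt_mult_alt by nra. rewrite sqrt_square by exact Hc. reflexivity.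
  - unfold inner. rewrite <- fsum_scal. apply fsum_ext. intros; ring.
Qed.

Lemma norm_le_1 w : norm d w <= 1 -> inner d w w <= 1.
Proof.
  intros H. unfold norm in H.
  destruct (Rle_lt_dec (inner d w w) 1) as [h|h]; [exact h|].
  assert (H1 := sqrt_lt_1_alt 1 _ (conj Rle_0_1 h)). rewrite sqrt_1 in H1. lra.
Qed.

End Inner.

Lemma inner_succ d w x :
  inner (S d) w x =
  w 0%nat * x 0%nat + inner d (fun j => w (S j)) (fun j => x (S j)).
Proof.
  unfold inner. cbn [seq fsum fold_right]. f_equal.
  rewrite <- seq_shift. apply fsum_map.
Qed.

Lemma norm_delta0 d : (0 < d)%nat -> norm d (fun i => if Nat.eq_dec i 0 then 1 else 0) = 1.
Proof.
  intros Hd. unfold norm. rewrite inner_delta by exact Hd. apply sqrt_1.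
Qed.

(** * Iterated expectations *)

Definition mass (D : fdist) : R := fsum (fun a => let '(x, y, p) := a in p) D.
Definition nonneg_weights (D : fdist) : Prop :=
  forall x y p, In (x, y, p) D -> 0 <= p.

(** The comparison is asked only on samples supported on the atoms of [D]; this matters when a bound
    on [f] fails for arbitrary samples. *)
Lemma expn_le_expn D n f g :
  nonneg_weights D -> (forall s, incl s (map fst D) -> f s <= g s) ->
  expn D n f <= expn D n g.
Proof.
  intros HD. revert f g. induction n as [|n IH]; simpl; intros f g H.
  - apply H. intros a [].
  - apply fsum_le. intros [[x y] p] Ha. apply Rmult_le_compat_l; [exact (HD _ _ _ Ha)|].
    apply IH. intros s Hs. apply H. apply incl_cons; [exact (in_map fst D _ Ha)|exact Hs].
Qed.

Lemma expn_const D n c : mass D = 1 -> expn D n (fun _ => c) = c.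
Proof.
  intros H1. induction n as [|n IH]; simpl; [reflexivity|]. rewrite IH.
  rewrite (fsum_ext _ (fun a => c * (let '(x, y, p) := a in p))).
  - rewrite fsum_scal. fold (mass D). rewrite H1; lra.
  - intros [[x y] p] _. lra.
Qed.

Lemma expn_le_const D n f c :
  nonneg_weights D -> mass D = 1 -> (forall s, f s <= c) -> expn D n f <= c.
Proof.
  intros HD H1 H. rewrite <- (expn_const D n c) by exact H1. apply expn_le_expn; auto.
Qed.

(** A draw from [D1] makes [f] nonpositive, so only samples drawn wholly from [D2] can contribute,
    and each draw costs a factor [mass D2]. *)
Lemma expn_miss D1 D2 n f :
  nonneg_weights (D1 ++ D2) -> mass (D1 ++ D2) = 1 -> (forall s, f s <= 1) ->
  (forall s a, incl s (map fst (D1 ++ D2)) -> In a (map fst D1) -> In a s -> f s <= 0) ->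
  expn (D1 ++ D2) n f <= mass D2 ^ n.
Proof.
  intros HD H1. revert f. induction n as [|n IH]; simpl; intros f Hf1 Hf0; [apply Hf1|].
  rewrite fsum_app.
  assert (fsum (fun a => let '(x, y, p) := a in
    p * expn (D1 ++ D2) n (fun s => f ((x, y) :: s))) D1 <= 0).
  { rewrite <- (fsum_zero (fun _ => 0) D1) by reflexivity. apply fsum_le.
    intros [[x y] p] Ha.
    assert (Ha' : In (x, y, p) (D1 ++ D2)) by (apply in_or_app; auto).
    assert (Hp := HD _ _ _ Ha').
    assert (expn (D1 ++ D2) n (fun s => f ((x, y) :: s)) <= 0); [|nra].
    rewrite <- (expn_const (D1 ++ D2) n 0) by exact H1.
    apply expn_le_expn; [exact HD|]. intros s Hs. apply (Hf0 _ (x, y)).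
    - apply incl_cons; [exact (in_map fst _ _ Ha')|exact Hs].
    - exact (in_map fst _ _ Ha).
    - left; reflexivity. }
  assert (fsum (fun a => let '(x, y, p) := a in
    p * expn (D1 ++ D2) n (fun s => f ((x, y) :: s))) D2 <= mass D2 * mass D2 ^ n); [|lra].
  rewrite (Rmult_comm (mass D2)). unfold mass at 2. rewrite <- fsum_scal.
  apply fsum_le. intros [[x y] p] Ha. rewrite (Rmult_comm _ p).
  assert (Ha' : In (x, y, p) (D1 ++ D2)) by (apply in_or_app; auto).
  apply Rmult_le_compat_l; [exact (HD _ _ _ Ha')|].
  apply IH; auto. intros s a Hs Ha1 Has. apply (Hf0 _ a); auto.
  - apply incl_cons; [exact (in_map fst _ _ Ha')|exact Hs].
  - right; exact Has.
Qed.

(** * Margin losses, empirical minimizers and their guarantees *)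

Lemma lossD_bounds g h D :
  nonneg_weights D -> mass D = 1 -> 0 <= lossD g h D <= 1.
Proof.
  intros HD H1. split.
  - apply fsum_nonneg. intros [[x y] p] Ha. apply HD in Ha.
    pose proof (ind_bounds (y * h x <= g)). nra.
  - rewrite <- H1. apply fsum_le. intros [[x y] p] Ha. apply HD in Ha.
    pose proof (ind_bounds (y * h x <= g)). nra.
Qed.

Lemma lossS_eq_0 g h s :
  (forall x y, In (x, y) s -> g < y * h x) -> lossS g h s = 0.
Proof.
  intros H. unfold lossS. rewrite fsum_zero; [lra|].
  intros [x y] Ha. apply ind_false. specialize (H x y Ha). lra.
Qed.

Lemma Rinv_INR_nonneg n : 0 <= / INR n.
Proof.
  destruct n as [|n]; [simpl; rewrite Rinv_0; lra|].
  left. apply Rinv_0_lt_compat, lt_0_INR. lia.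
Qed.

Lemma lossS_nonneg g h s : 0 <= lossS g h s.
Proof.
  unfold lossS. apply Rmult_le_pos; [apply Rinv_INR_nonneg|].
  apply fsum_nonneg. intros [x y] _. apply ind_bounds.
Qed.

Lemma lossS_le_0 g h s x y :
  lossS g h s <= 0 -> In (x, y) s -> g < y * h x.
Proof.
  intros H Hs. unfold lossS in H.
  assert (0 < / INR (length s)).
  { apply Rinv_0_lt_compat. apply lt_0_INR. destruct s; simpl in *; [easy|lia]. }
  assert (H1 := fsum_elem_le (fun a : point * R => let '(x, y) := a in ind (y * h x <= g)) s (x, y)).
  simpl in H1. destruct (Rlt_le_dec g (y * h x)) as [h1|h1]; [exact h1|].
  rewrite (ind_true (y * h x <= g)) in H1 by exact h1.
  assert (1 <= fsum (fun a : point * R => let '(x, y) := a in ind (y * h x <= g)) s).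
  { apply H1; [|exact Hs]. intros [x' y'] _. apply ind_bounds. }
  nra.
Qed.

Lemma nat_valued_min {A : Type} (Q : A -> Prop) (f : A -> nat) :
  (exists a, Q a) -> exists a, Q a /\ forall b, Q b -> (f a <= f b)%nat.
Proof.
  intros [a Ha]. remember (f a) as m eqn:Em. revert a Ha Em.
  induction m as [m IH] using lt_wf_ind. intros a Ha ->.
  destruct (classic (exists b, Q b /\ (f b < f a)%nat)) as [[b [Hb Hlt]]|H].
  - apply (IH (f b) Hlt b Hb eq_refl).
  - exists a. split; [exact Ha|]. intros b Hb.
    destruct (Nat.le_gt_cases (f a) (f b)); [assumption|]. exfalso; eauto.
Qed.

Definition argmin (d : nat) (g : R) (s : sample) (w : point) : Prop :=
  norm d w <= 1 /\
  forall v, norm d v <= 1 -> lossS g (inner d w) s <= lossS g (inner d v) s.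

(** The empirical loss is a fixed multiple of the number of violated examples, and a natural-valued
    quantity attains its minimum. Compactness of the ball would not suffice, as the loss is not
    lower semicontinuous in [w]. *)
Lemma argmin_ex d g s : exists w, argmin d g s w.
Proof.
  destruct (nat_valued_min (fun w => norm d w <= 1)
    (fun w => length (filter (fun a : point * R =>
      if excluded_middle_informative (snd a * inner d w (fst a) <= g)
      then true else false) s))) as [w [Hw Hmin]].
  - exists (fun _ => 0). unfold norm. replace (inner d _ _) with 0; [rewrite sqrt_0; lra|].
    symmetry. apply fsum_zero. intros; lra.
  - exists w. split; [exact Hw|]. intros v Hv. specialize (Hmin v Hv).
    apply le_INR in Hmin. rewrite <- !fsum_ind in Hmin.
    unfold lossS. apply Rmult_le_compat_l.
    + apply Rinv_INR_nonneg.
    + rewrite (fsum_ext (fun a => let '(x, y) := a in ind (y * inner d w x <= g))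
        (fun a => ind (snd a * inner d w (fst a) <= g))) by (intros [? ?]; reflexivity).
      rewrite (fsum_ext (fun a => let '(x, y) := a in ind (y * inner d v x <= g))
        (fun a => ind (snd a * inner d v (fst a) <= g))) by (intros [? ?]; reflexivity).
      exact Hmin.
Qed.

(** Adversarial tie-breaking: sample complexity quantifies over all MEM algorithms, so a lower bound
    may use one that picks a bad minimizer whenever some minimizer is bad. *)
Lemma MEM_prefer d (B : point -> Prop) :
  exists A, is_MEM d A /\
    forall g s, 0 < g -> (exists w, argmin d g s w /\ B w) -> B (A g s).
Proof.
  destruct (choice (fun (gs : R * sample) w => argmin d (fst gs) (snd gs) w /\
    ((exists w, argmin d (fst gs) (snd gs) w /\ B w) -> B w))) as [A HA].
  - intros [g s]; simpl.
    destruct (classic (exists w, argmin d g s w /\ B w)) as [[w [Hw HB]]|H].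
    + exists w; auto.
    + destruct (argmin_ex d g s) as [w Hw]. exists w; tauto.
  - exists (fun g s => A (g, s)). split.
    + intros g s _. exact (proj1 (HA (g, s))).
    + intros g s _ H. exact (proj2 (HA (g, s)) H).
Qed.

Lemma l0A_le d Ag D n delta eps :
  0 <= eps -> probn D n (fun s => lossD 0 (inner d (Ag s)) D >= eps) <= delta ->
  l0A d Ag D n delta <= eps.
Proof. intros H1 H2. apply (Rinf_le _ 0); [intros x [Hx _]; exact Hx|auto]. Qed.

Lemma l0A_ge d Ag D n delta m :
  nonneg_weights D -> mass D = 1 -> 0 < delta ->
  delta < probn D n (fun s => lossD 0 (inner d (Ag s)) D >= m) ->
  m <= l0A d Ag D n delta.
Proof.
  intros HD H1 Hdelta H. apply Rinf_ge.
  (* Losses never exceed 1, so the threshold 2 is reached with probability 0 and the set is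
     nonempty. *)
  - exists 2. split; [lra|]. apply Rle_trans with 0; [|lra].
    apply expn_le_const; auto. intros s. rewrite ind_false; [lra|].
    pose proof (lossD_bounds 0 (inner d (Ag s)) D HD H1). lra.
  - intros e [He1 He2]. destruct (Rle_lt_dec m e) as [h|h]; [exact h|].
    assert (probn D n (fun s => lossD 0 (inner d (Ag s)) D >= m) <=
            probn D n (fun s => lossD 0 (inner d (Ag s)) D >= e)); [|lra].
    apply expn_le_expn; auto. intros s _. apply ind_le. lra.
Qed.

Lemma lstar_eq_0 d g D w :
  nonneg_weights D -> mass D = 1 -> norm d w <= 1 -> lossD g (inner d w) D = 0 ->
  lstar d g D = 0.
Proof.
  intros HD H1 Hw H0.
  assert (Hlow : forall v, (exists w, norm d w <= 1 /\ v = lossD g (inner d w) D) -> 0 <= v).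
  { intros v [w' [_ ->]]. apply lossD_bounds; assumption. }
  apply Rle_antisym.
  - apply (Rinf_le _ 0); [exact Hlow|]. exists w; auto.
  - apply Rinf_ge; [|exact Hlow]. exists 0, w; auto.
Qed.

(** * The discrete cube *)

Definition sgn (b : bool) : R := if b then 1 else -1.

Fixpoint cubebits (d : nat) : list (list bool) :=
  match d with
  | O => [nil]
  | S k => map (cons true) (cubebits k) ++ map (cons false) (cubebits k)
  end.

Definition signs (b : list bool) : point := fun j => sgn (nth j b false).
Definition label (b : list bool) : R := signs b 0%nat.
Definition scales (a s : R) : point := fun j => match j with O => a | S _ => s end.
Definition vertex (a s : R) (b : list bool) : point := fun j => scales a s j * signs b j.
(** For [s = 0] the points collapse onto the first axis, but all [2 ^ d] entries are kept, so that
    the facts about cubes cover the flat cube too. *)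
Definition cube (d : nat) (a s q : R) : fdist :=
  map (fun b => (vertex a s b, label b, q)) (cubebits d).

Lemma sgn_sqr b : sgn b * sgn b = 1.
Proof. destruct b; simpl; lra. Qed.

Lemma sgn_inj b b' : sgn b = sgn b' -> b = b'.
Proof. destruct b, b'; simpl; intros; try reflexivity; lra. Qed.

Lemma label_sqr b : label b * label b = 1.
Proof. apply sgn_sqr. Qed.

Lemma cubebits_length d : length (cubebits d) = (2 ^ d)%nat.
Proof. induction d as [|d IH]; simpl; [|rewrite length_app, !length_map, IH]; lia. Qed.

Lemma INR_cubebits d : INR (length (cubebits d)) = 2 ^ d.
Proof. rewrite cubebits_length, pow_INR. reflexivity. Qed.

Lemma in_cubebits d b : In b (cubebits d) <-> length b = d.
Proof.
  revert b. induction d as [|d IH]; intros b; simpl.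
  - split; [intros [<-|[]]; reflexivity|]. destruct b; simpl; [auto|lia].
  - rewrite in_app_iff, !in_map_iff. split.
    + intros [[c [<- Hc]]|[c [<- Hc]]]; apply IH in Hc; simpl; lia.
    + destruct b as [|[] c]; simpl; intros Hc; [lia| |];
        [left|right]; exists c; (split; [reflexivity|apply IH; lia]).
Qed.

Lemma cubebits_NoDup d : NoDup (cubebits d).
Proof.
  induction d as [|d IH]; simpl; [repeat constructor; auto|].
  apply NoDup_app.
  - apply NoDup_map_NoDup_ForallPairs; [|exact IH]. intros c c' _ _ E; congruence.
  - apply NoDup_map_NoDup_ForallPairs; [|exact IH]. intros c c' _ _ E; congruence.
  - intros b. rewrite !in_map_iff. intros [c [<- _]] [c' [E _]]. discriminate.
Qed.

Lemma fsum_cubebits_S (f : list bool -> R) d :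
  fsum f (cubebits (S d)) =
  fsum (fun c => f (true :: c)) (cubebits d) + fsum (fun c => f (false :: c)) (cubebits d).
Proof. simpl. rewrite fsum_app, !fsum_map. reflexivity. Qed.

(** * Moments of uniform sign vectors *)

Lemma antitone_of_derive_nonpos (f f' : R -> R) (x : R) :
  0 <= x -> (forall t, is_derive f t (f' t)) -> (forall t, 0 <= t -> f' t <= 0) ->
  f x <= f 0.
Proof.
  intros Hx Hf Hf'. destruct (MVT_gen f 0 x f') as [c [Hc E]].
  - intros t _. apply Hf.
  - intros t _. apply continuity_pt_filterlim. apply (ex_derive_continuous f). eexists; apply Hf.
  - rewrite Rmin_left in Hc by exact Hx. specialize (Hf' c ltac:(lra)). nra.
Qed.

(** On [t >= 0] the product of [cosh t] and [exp (- t ^ 2 / 2)] is nonincreasing: its derivative has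
    the sign of [sinh t - t * cosh t], which starts at 0 and has derivative [- t * sinh t]. Negative
    arguments follow by evenness. *)
Lemma cosh_le_exp x : (exp x + exp (- x)) / 2 <= exp (x ^ 2 / 2).
Proof.
  assert (Hsinh : forall t, 0 <= t -> exp (- t) <= exp t).
  { intros t Ht. destruct (Rle_lt_or_eq_dec 0 t Ht) as [h|<-];
      [left; apply exp_increasing; lra|rewrite Ropp_0; lra]. }
  assert (Hk : forall t, 0 <= t -> (exp t - exp (- t)) - t * (exp t + exp (- t)) <= 0).
  { intros t Ht.
    replace 0 with ((exp 0 - exp (- 0)) - 0 * (exp 0 + exp (- 0))) by (rewrite Ropp_0; ring).
    apply (antitone_of_derive_nonpos
      (fun t => (exp t - exp (- t)) - t * (exp t + exp (- t)))
      (fun t => - (t * (exp t - exp (- t))))); [exact Ht| |].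
    - intros u. auto_derive; [trivial|]. ring.
    - intros u Hu. specialize (Hsinh u Hu). nra. }
  assert (H : forall t, 0 <= t -> (exp t + exp (- t)) / 2 <= exp (t ^ 2 / 2)).
  { intros t Ht.
    assert (H : (exp t + exp (- t)) * exp (- (t ^ 2 / 2)) <=
                (exp 0 + exp (- 0)) * exp (- (0 ^ 2 / 2))).
    { apply (antitone_of_derive_nonpos
        (fun t => (exp t + exp (- t)) * exp (- (t ^ 2 / 2)))
        (fun t => ((exp t - exp (- t)) - t * (exp t + exp (- t))) * exp (- (t ^ 2 / 2))));
        [exact Ht| |].
      - intros u. auto_derive; [trivial|]. unfold pow, Rdiv. field.
      - intros u Hu. specialize (Hk u Hu). pose proof (exp_pos (- (u ^ 2 / 2))). nra. }
    replace (- (0 ^ 2 / 2)) with 0 in H by lra. rewrite Ropp_0, exp_0 in H.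
    rewrite (exp_Ropp (t ^ 2 / 2)) in H. pose proof (exp_pos (t ^ 2 / 2)).
    apply (Rmult_le_compat_r (exp (t ^ 2 / 2))) in H; [|lra].
    rewrite Rmult_assoc, Rinv_l in H by lra. lra. }
  destruct (Rle_lt_dec 0 x) as [h|h]; [apply H, h|].
  replace (x ^ 2) with ((- x) ^ 2) by ring. specialize (H (- x) ltac:(lra)).
  rewrite Ropp_involutive in H. lra.
Qed.

(** The moment generating function of independent signs factors into hyperbolic cosines; the
    induction splits off one coordinate and bounds its factor. *)
Lemma cube_exp_moment d v :
  fsum (fun b => exp (inner d v (signs b))) (cubebits d) <= 2 ^ d * exp (inner d v v / 2).
Proof.
  revert v. induction d as [|d IH]; intros v.
  - unfold inner; simpl. replace (0 / 2) with 0 by lra. lra.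
  - rewrite fsum_cubebits_S.
    rewrite (fsum_ext _ (fun c => exp (v 0%nat) * exp (inner d (fun j => v (S j)) (signs c)))).
    2:{ intros c _. rewrite inner_succ, <- exp_plus. f_equal. unfold signs at 1; simpl.
        rewrite Rmult_1_r. reflexivity. }
    rewrite (fsum_ext (fun c => exp (inner (S d) v (signs (false :: c))))
      (fun c => exp (- v 0%nat) * exp (inner d (fun j => v (S j)) (signs c)))).
    2:{ intros c _. rewrite inner_succ, <- exp_plus. f_equal. unfold signs at 1; simpl.
        f_equal. lra. }
    rewrite !fsum_scal, <- Rmult_plus_distr_r, inner_succ.
    replace ((v 0%nat * v 0%nat + inner d (fun j => v (S j)) (fun j => v (S j))) / 2)
      with ((v 0%nat) ^ 2 / 2 + inner d (fun j => v (S j)) (fun j => v (S j)) / 2) by lra.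
    rewrite exp_plus.
    pose proof (cosh_le_exp (v 0%nat)). specialize (IH (fun j => v (S j))).
    pose proof (exp_pos (v 0%nat)). pose proof (exp_pos (- v 0%nat)).
    simpl pow at 1.
    replace (2 * 2 ^ d * (exp (v 0%nat ^ 2 / 2) * exp (inner d (fun j => v (S j)) (fun j => v (S j)) / 2)))
      with ((2 * exp (v 0%nat ^ 2 / 2)) * (2 ^ d * exp (inner d (fun j => v (S j)) (fun j => v (S j)) / 2))) by ring.
    apply Rmult_le_compat; try lra.
    apply fsum_nonneg. intros; left; apply exp_pos.
Qed.

(** The shift [c] is there for the induction, where it absorbs the term [± v 0] of the coordinate
    split off; the cross terms cancel. *)
Lemma cube_second_moment d v c :
  fsum (fun b => (c + inner d v (signs b)) ^ 2) (cubebits d) = 2 ^ d * (c ^ 2 + inner d v v).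
Proof.
  revert v c. induction d as [|d IH]; intros v c.
  - unfold inner; simpl. ring.
  - rewrite fsum_cubebits_S.
    rewrite (fsum_ext _ (fun b => ((c + v 0%nat) + inner d (fun j => v (S j)) (signs b)) ^ 2)).
    2:{ intros b _. rewrite inner_succ. unfold signs at 1; simpl. unfold signs. simpl. ring. }
    rewrite (fsum_ext (fun b => (c + inner (S d) v (signs (false :: b))) ^ 2)
      (fun b => ((c - v 0%nat) + inner d (fun j => v (S j)) (signs b)) ^ 2)).
    2:{ intros b _. rewrite inner_succ. unfold signs at 1; simpl. unfold signs. simpl. ring. }
    rewrite !IH, inner_succ. simpl. ring.
Qed.

Lemma cube_mean d i :
  (i < d)%nat -> fsum (fun b => signs b i) (cubebits d) = 0.
Proof.
  revert i. induction d as [|d IH]; intros i Hi; [lia|]. rewrite fsum_cubebits_S.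
  destruct i as [|i].
  - unfold signs; simpl. rewrite !fsum_const. lra.
  - unfold signs in *; simpl. rewrite IH by lia. lra.
Qed.

Lemma cube_cov d i j :
  (i < d)%nat -> (j < d)%nat ->
  fsum (fun b => signs b i * signs b j) (cubebits d) = if Nat.eq_dec i j then 2 ^ d else 0.
Proof.
  intros Hi Hj. destruct Nat.eq_dec as [<-|Hij].
  - rewrite (fsum_ext _ (fun _ => 1)) by (intros; apply sgn_sqr).
    rewrite fsum_const, INR_cubebits. lra.
  - revert i j Hi Hj Hij. induction d as [|d IH]; intros i j Hi Hj Hij; [lia|].
    rewrite fsum_cubebits_S. destruct i as [|i], j as [|j]; [lia| | |].
    + assert (H := cube_mean d j). unfold signs in *; simpl. rewrite !fsum_scal, H by lia. lra.
    + assert (H := cube_mean d i). unfold signs in *; simpl.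
      rewrite (fsum_ext _ (fun c => 1 * sgn (nth i c false))) by (intros; ring).
      rewrite (fsum_ext (fun c => sgn (nth i c false) * -1)
        (fun c => (-1) * sgn (nth i c false))) by (intros; ring).
      rewrite !fsum_scal, H by lia. lra.
    + unfold signs in *; simpl. rewrite IH by lia. lra.
Qed.

(** * Expectations and losses of cube distributions *)

Lemma inner_vertex d w a s b :
  inner d w (vertex a s b) = inner d (fun j => w j * scales a s j) (signs b).
Proof. apply fsum_ext. intros j _. unfold vertex. ring. Qed.

Lemma expectX_app D1 D2 f : expectX (D1 ++ D2) f = expectX D1 f + expectX D2 f.
Proof. apply fsum_app. Qed.

Lemma lossD_app g h D1 D2 : lossD g h (D1 ++ D2) = lossD g h D1 + lossD g h D2.
Proof. apply fsum_app. Qed.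

Lemma mass_app D1 D2 : mass (D1 ++ D2) = mass D1 + mass D2.
Proof. apply fsum_app. Qed.

Section Cube.
Variables (d : nat) (a s q : R).

Lemma cube_expectX f :
  expectX (cube d a s q) f = q * fsum (fun b => f (vertex a s b)) (cubebits d).
Proof. unfold expectX, cube. rewrite fsum_map. apply fsum_scal. Qed.

Lemma cube_mass : mass (cube d a s q) = 2 ^ d * q.
Proof. unfold mass, cube. rewrite fsum_map, fsum_const, INR_cubebits. reflexivity. Qed.

Lemma cube_nonneg : 0 <= q -> nonneg_weights (cube d a s q).
Proof.
  intros Hq x y p H. apply in_map_iff in H. destruct H as [b [E _]]. congruence.
Qed.

Lemma cube_labels x y p : In (x, y, p) (cube d a s q) -> y = 1 \/ y = -1.
Proof.
  intros H. apply in_map_iff in H. destruct H as [b [E _]]. injection E as _ <- _.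
  unfold label, signs. destruct (nth 0 b false); simpl; auto.
Qed.

Lemma cube_expectX_coord i :
  (i < d)%nat -> expectX (cube d a s q) (fun x => x i) = 0.
Proof.
  intros Hi. rewrite cube_expectX. unfold vertex. rewrite fsum_scal, cube_mean by exact Hi. ring.
Qed.

Lemma cube_expectX_prod i j :
  (i < d)%nat -> (j < d)%nat ->
  expectX (cube d a s q) (fun x => x i * x j) =
  if Nat.eq_dec i j then 2 ^ d * q * scales a s i ^ 2 else 0.
Proof.
  intros Hi Hj. rewrite cube_expectX. unfold vertex.
  rewrite (fsum_ext _ (fun b => (scales a s i * scales a s j) * (signs b i * signs b j)))
    by (intros; ring).
  rewrite fsum_scal, cube_cov by assumption.
  destruct Nat.eq_dec as [<-|]; ring.
Qed.

Lemma cube_expectX_sqr u :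
  expectX (cube d a s q) (fun x => inner d u x ^ 2) =
  2 ^ d * q * inner d (fun j => u j * scales a s j) (fun j => u j * scales a s j).
Proof.
  rewrite cube_expectX.
  rewrite (fsum_ext _ (fun b => (0 + inner d (fun j => u j * scales a s j) (signs b)) ^ 2)).
  - rewrite cube_second_moment. ring.
  - intros b _. rewrite inner_vertex. ring.
Qed.

Lemma cube_expectX_exp u t :
  0 <= q ->
  expectX (cube d a s q) (fun x => exp (t * inner d u x)) <=
  2 ^ d * q * exp (t ^ 2 * inner d (fun j => u j * scales a s j) (fun j => u j * scales a s j) / 2).
Proof.
  intros Hq. rewrite cube_expectX, (Rmult_comm _ q), Rmult_assoc.
  apply Rmult_le_compat_l; [exact Hq|].
  rewrite (fsum_ext _ (fun b => exp (inner d (fun j => t * (u j * scales a s j)) (signs b)))).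
  - eapply Rle_trans; [apply cube_exp_moment|]. right. do 3 f_equal.
    unfold inner. rewrite <- fsum_scal. apply fsum_ext. intros; ring.
  - intros b _. rewrite inner_vertex, <- inner_scal. reflexivity.
Qed.

Lemma cube_lossD g h :
  lossD g h (cube d a s q) =
  q * fsum (fun b => ind (label b * h (vertex a s b) <= g)) (cubebits d).
Proof. unfold lossD, cube. rewrite fsum_map. apply fsum_scal. Qed.

Lemma cube_lossD_0 g h :
  (forall b, g < label b * h (vertex a s b)) -> lossD g h (cube d a s q) = 0.
Proof.
  intros H. rewrite cube_lossD, fsum_zero; [ring|].
  intros b _. apply ind_false. specialize (H b). lra.
Qed.

Lemma cube_expn_S n f :
  expn (cube d a s q) (S n) f =
  q * fsum (fun b => expn (cube d a s q) n (fun S => f ((vertex a s b, label b) :: S)))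
        (cubebits d).
Proof. cbn [expn]. unfold cube at 2. rewrite fsum_map. apply fsum_scal. Qed.

End Cube.

(* Flipping the label coordinate flips the label but not the prediction of [w]. *)
Lemma cube_lossD_ge_half d a s w :
  (0 < d)%nat -> w 0%nat = 0 -> / 2 <= lossD 0 (inner d w) (cube d a s (/ 2 ^ d)).
Proof.
  intros Hd Hw. destruct d as [|d]; [lia|]. rewrite cube_lossD, fsum_cubebits_S, <- fsum_plus.
  assert (Hp : 0 < 2 ^ d) by (apply pow_lt; lra).
  assert (H : 2 ^ d * 1 <= fsum (fun c =>
    ind (label (true :: c) * inner (S d) w (vertex a s (true :: c)) <= 0) +
    ind (label (false :: c) * inner (S d) w (vertex a s (false :: c)) <= 0)) (cubebits d)).
  { rewrite <- INR_cubebits, <- fsum_const. apply fsum_le. intros c _.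
    rewrite !inner_succ, Hw, !Rmult_0_l, !Rplus_0_l.
    change (fun j => vertex a s (true :: c) (S j)) with (fun j => s * signs c j).
    change (fun j => vertex a s (false :: c) (S j)) with (fun j => s * signs c j).
    set (z := inner d _ _). unfold label, signs; simpl.
    pose proof (ind_bounds (1 * z <= 0)). pose proof (ind_bounds (-1 * z <= 0)).
    destruct (Rle_lt_dec z 0); [rewrite (ind_true (1 * z <= 0))|rewrite (ind_true (-1 * z <= 0))]; lra. }
  apply (Rmult_le_compat_l (/ 2 ^ S d)) in H;
    [|left; apply Rinv_0_lt_compat, pow_lt; lra].
  eapply Rle_trans; [|exact H]. right. simpl. field. lra.
Qed.

(** * Linear independence of random sign vectors *)

(** Linear independence of the sign vectors with coordinate 0 deleted, in a form carrying a
    certificate: [J] lists pivot coordinates on which the square system is solvable for every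
    right-hand side. *)
Definition interpolates (d : nat) (J : list nat) (bs : list (list bool)) : Prop :=
  length J = length bs /\ (forall j, In j J -> (0 < j < d)%nat) /\
  forall t, length t = length bs ->
    exists w, (forall j, ~ In j J -> w j = 0) /\
      map (fun b => inner d w (signs b)) bs = t.

Lemma interpolates_nil d : interpolates d nil nil.
Proof.
  split; [reflexivity|split; [intros j []|]]. intros [|] E; [|discriminate].
  exists (fun _ => 0). auto.
Qed.

Lemma interpolates_cons d J bs b j v :
  interpolates d J bs -> (0 < j < d)%nat ->
  (forall i, ~ In i (j :: J) -> v i = 0) ->
  (forall c, In c bs -> inner d v (signs c) = 0) -> inner d v (signs b) <> 0 ->
  interpolates d (j :: J) (b :: bs).
Proof.
  intros [HJ [Hr Hi]] Hj Hv H0 Hb. split; [simpl; auto|split].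
  - intros i [<-|H]; auto.
  - intros [|t0 t] Ht; [discriminate|]. simpl in Ht.
    destruct (Hi t) as [w [Hw Ew]]; [lia|].
    (* As [v] vanishes on [bs], adding a multiple of it corrects the value at [b] without disturbing
       the others. *)
    exists (fun i => w i + (t0 - inner d w (signs b)) / inner d v (signs b) * v i). split.
    + intros i Hn. rewrite Hv by exact Hn. rewrite Hw by (simpl in Hn; tauto). ring.
    + simpl. f_equal.
      * rewrite inner_plus, inner_scal. field. exact Hb.
      * rewrite <- Ew. apply map_ext_in. intros c Hc.
        rewrite inner_plus, inner_scal, (H0 c Hc). ring.
Qed.

(** Interpolating the negated [j]-th coordinates expresses coordinate [j] on [bs] through the
    pivots. *)
Lemma interpolates_pivot d J bs j :
  interpolates d J bs -> (j < d)%nat ->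
  exists w, (forall i, ~ In i J -> w i = 0) /\
    forall c, In c bs -> signs c j + inner d w (signs c) = 0.
Proof.
  intros [_ [_ Hi]] Hj. destruct (Hi (map (fun c => - signs c j) bs)) as [w [Hw Ew]].
  - apply length_map.
  - exists w. split; [exact Hw|]. intros c Hc.
    assert (E := ext_in_map Ew c Hc). simpl in E. lra.
Qed.

(* Odlyzko's bound: a vertex that does not extend the family lies in the span of [bs]
   in the coordinates [> 0], hence is determined by the pivots [J] and coordinate 0. *)
Lemma nonextending_count d J bs :
  interpolates d J bs ->
  fsum (fun b => ind (~ exists J', interpolates d J' (b :: bs))) (cubebits d)
  <= 2 * 2 ^ length bs.
Proof.
  intros H. rewrite fsum_ind. set (F := filter _ _).
  assert (HF : forall b, In b F -> length b = d /\ ~ exists J', interpolates d J' (b :: bs)).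
  { intros b Hb. apply filter_In in Hb. destruct Hb as [Hb1 Hb2].
    apply in_cubebits in Hb1. destruct excluded_middle_informative; [auto|discriminate]. }
  change (2 * 2 ^ length bs) with (2 ^ S (length bs)).
  rewrite <- (proj1 H), <- INR_cubebits. apply le_INR.
  (* Reading off the bits at 0 and [J] is injective on [F]; the extra bit at 0 accounts for the
     factor 2. *)
  rewrite <- (length_map (fun b => map (fun j => nth j b false) (0%nat :: J)) F).
  apply NoDup_incl_length.
  - apply NoDup_map_NoDup_ForallPairs; [|apply NoDup_filter, cubebits_NoDup].
    intros b b' Hb Hb' E. destruct (HF b Hb) as [Lb Nb], (HF b' Hb') as [Lb' Nb'].
    assert (EJ : forall j, In j (0%nat :: J) -> nth j b false = nth j b' false)
      by exact (ext_in_map E).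
    apply (nth_ext _ _ false false); [congruence|]. intros j Hj.
    destruct (in_dec Nat.eq_dec j (0%nat :: J)) as [Hin|Hin]; [apply EJ, Hin|].
    assert (Hjd : (0 < j < d)%nat) by (simpl in Hin; lia).
    destruct (interpolates_pivot d J bs j H) as [w [Hw H0]]; [lia|].
    (* This functional annihilates [bs]; were it nonzero on a nonextending vertex, [j] would serve
       as a new pivot. *)
    set (v := fun i => (if Nat.eq_dec i j then 1 else 0) + w i).
    assert (Hv : forall c, inner d v (signs c) = signs c j + inner d w (signs c)).
    { intros c. unfold v. rewrite inner_plus, inner_delta by lia. reflexivity. }
    assert (Hz : forall c, (~ exists J', interpolates d J' (c :: bs)) ->
      signs c j + inner d w (signs c) = 0).
    { intros c Hc. apply NNPP. intros Hne. apply Hc. exists (j :: J).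
      apply (interpolates_cons d J bs c j v); auto.
      - intros i Hi. simpl in Hi. unfold v. destruct Nat.eq_dec as [->|]; [tauto|].
        rewrite Hw by tauto. ring.
      - intros c' Hc'. rewrite Hv. auto.
      - rewrite Hv. exact Hne. }
    apply sgn_inj. change (signs b j = signs b' j).
    (* [w] sees only the pivots, where the two vertices agree, so their [j]-th coordinates agree as
       well. *)
    assert (Ew : inner d w (signs b) = inner d w (signs b')).
    { apply fsum_ext. intros i _. destruct (in_dec Nat.eq_dec i J) as [Hi|Hi].
      - unfold signs. rewrite EJ by (simpl; auto). reflexivity.
      - rewrite Hw by exact Hi. ring. }
    apply Hz in Nb, Nb'. lra.
  - intros x Hx. apply in_map_iff in Hx. destruct Hx as [b [<- _]].
    apply in_cubebits. rewrite length_map. reflexivity.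
Qed.

(** Union bound: with [k] vectors already present, the next draw fails to extend the family with
    probability at most [2 * 2 ^ k / 2 ^ d], and the geometric sum over the [n] draws gives the
    deficit. Draws are pushed onto [bs] one by one, hence [rev_append]. *)
Lemma expn_interpolates d a s n bs J f :
  interpolates d J bs -> (forall S, 0 <= f S) ->
  (forall cs, length cs = n -> (forall c, In c cs -> length c = d) ->
     (exists J', interpolates d J' (rev_append cs bs)) ->
     1 <= f (map (fun c => (vertex a s c, label c)) cs)) ->
  1 - 2 * / 2 ^ d * (2 ^ length bs * (2 ^ n - 1)) <= expn (cube d a s (/ 2 ^ d)) n f.
Proof.
  revert bs J f. induction n as [|n IH]; intros bs J f HJ Hf0 Hf1.
  - assert (H1 := Hf1 nil eq_refl (fun c (H : In c nil) => match H with end)).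
    simpl in *. assert (1 <= f nil) by eauto. lra.
  - assert (Hq : 0 < / 2 ^ d) by (apply Rinv_0_lt_compat, pow_lt; lra).
    assert (Hk : 0 < 2 ^ length bs) by (apply pow_lt; lra).
    assert (Hn : 1 <= 2 ^ n) by (apply pow_R1_Rle; lra).
    (* The deficit that the induction hypothesis gives for a family longer by one. *)
    set (beta := 2 * / 2 ^ d * (2 * 2 ^ length bs * (2 ^ n - 1))).
    assert (Hbeta : 0 <= beta).
    { unfold beta. repeat apply Rmult_le_pos; lra. }
    rewrite cube_expn_S.
    assert (H : fsum (fun b => (1 - beta) +
        (-1) * ind (~ exists J', interpolates d J' (b :: bs))) (cubebits d) <=
      fsum (fun b => expn (cube d a s (/ 2 ^ d)) n
        (fun S => f ((vertex a s b, label b) :: S))) (cubebits d)).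
    { apply fsum_le. intros b Hb. apply in_cubebits in Hb.
      destruct (classic (exists J', interpolates d J' (b :: bs))) as [[J' HJ']|Hbad].
      - rewrite ind_false by (intros H; apply H; eauto).
        assert (1 - beta <= expn (cube d a s (/ 2 ^ d)) n
          (fun S => f ((vertex a s b, label b) :: S))); [|lra].
        apply (IH (b :: bs) J'); auto.
        intros cs Hl Hd Hi. apply (Hf1 (b :: cs)); simpl; auto.
        intros c [<-|Hc]; auto.
      (* After a failed draw only nonnegativity of the expectation is used. *)
      - rewrite ind_true by exact Hbad.
        assert (0 <= expn (cube d a s (/ 2 ^ d)) n
          (fun S => f ((vertex a s b, label b) :: S))); [|lra].
        rewrite <- (expn_const (cube d a s (/ 2 ^ d)) n 0).
        + apply expn_le_expn; auto. apply cube_nonneg. lra.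
        + rewrite cube_mass. apply Rinv_r. apply pow_nonzero. lra. }
    rewrite fsum_plus, fsum_const, INR_cubebits, fsum_scal in H.
    assert (Hc := nonextending_count d J bs HJ).
    apply (Rmult_le_compat_l (/ 2 ^ d)) in H; [|lra].
    eapply Rle_trans; [|exact H].
    set (N := fsum (fun b => ind (~ exists J', interpolates d J' (b :: bs))) (cubebits d)) in *.
    assert (E : / 2 ^ d * (2 ^ d * (1 - beta) + -1 * N) = 1 - beta - / 2 ^ d * N)
      by (field; apply pow_nonzero; lra).
    rewrite E.
    apply (Rmult_le_compat_l (/ 2 ^ d)) in Hc; [|lra].
    assert (E2 : 2 * / 2 ^ d * (2 ^ length bs * (2 ^ S n - 1)) =
                 beta + / 2 ^ d * (2 * 2 ^ length bs)) by (unfold beta; simpl; ring).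
    lra.
Qed.

(** * A uniform norm bound for separators *)

Lemma uniform_bound_list {A : Type} (Q : A -> R -> Prop) (l : list A) :
  (forall a m m', m <= m' -> Q a m -> Q a m') ->
  (forall a, In a l -> exists m, Q a m) -> exists m, forall a, In a l -> Q a m.
Proof.
  intros Hmono. induction l as [|a l IH]; intros H; [exists 0; easy|].
  destruct (H a) as [m1 H1]; [simpl; auto|]. destruct IH as [m2 H2].
  { intros; apply H; simpl; auto. }
  exists (Rmax m1 m2). intros b [<-|Hb].
  - apply (Hmono a m1); [apply Rmax_l|exact H1].
  - apply (Hmono b m2); [apply Rmax_r|auto].
Qed.

(** There are finitely many samples of length [n] over [l], so their individual bounds have a common
    maximum. *)
Lemma uniform_bound_samples {A : Type} (l : list A) (n : nat) (Q : list A -> R -> Prop) :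
  (forall u m m', m <= m' -> Q u m -> Q u m') ->
  (forall u, exists m, Q u m) ->
  exists m, forall u, length u = n -> (forall a, In a u -> In a l) -> Q u m.
Proof.
  revert Q. induction n as [|n IH]; intros Q Hmono H.
  - destruct (H nil) as [m Hm]. exists m. intros [|] E _; [exact Hm|discriminate].
  - destruct (uniform_bound_list (fun a m => forall u, length u = n ->
      (forall a, In a u -> In a l) -> Q (a :: u) m) l) as [m Hm].
    + intros a m m' Hle HQ u Hu Hl. apply (Hmono _ m); auto.
    + intros a _. apply (IH (fun u => Q (a :: u))); eauto.
    + exists m. intros [|a u] E Hl; [discriminate|]. apply Hm; simpl in *; auto.
Qed.

(** [M] depends on [d] and [n] alone, so the side length of the cube can be fixed before the sample
    is drawn. The separator interpolates the labels; its coordinate 0 vanishes because pivots are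
    positive. *)
Lemma separator_bound d n :
  exists M, 0 < M /\ forall bs, length bs = n -> (forall b, In b bs -> length b = d) ->
    (exists J, interpolates d J bs) ->
    exists w, norm d w <= M /\ w 0%nat = 0 /\
      forall b, In b bs -> inner d w (signs b) = label b.
Proof.
  destruct (uniform_bound_samples (cubebits d) n (fun bs m => (exists J, interpolates d J bs) ->
    exists w, norm d w <= m /\ w 0%nat = 0 /\
      forall b, In b bs -> inner d w (signs b) = label b)) as [m Hm].
  - intros u m m' Hle HQ HJ. destruct (HQ HJ) as [w [H1 H2]]. exists w. split; [lra|exact H2].
  - intros u. destruct (classic (exists J, interpolates d J u)) as [[J [HJ [Hr Hi]]]|H].
    + destruct (Hi (map label u)) as [w [Hw Ew]]; [apply length_map|].
      exists (norm d w). intros _. exists w. split; [lra|split].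
      * apply Hw. intros H0. apply Hr in H0. lia.
      * intros b Hb. exact (ext_in_map Ew b Hb).
    + exists 0. tauto.
  - exists (Rmax m 1). split; [pose proof (Rmax_r m 1); lra|].
    intros bs Hl Hd HJ. destruct (Hm bs) as [w [H1 H2]]; auto.
    + intros b Hb. apply in_cubebits. auto.
    + exists w. split; [pose proof (Rmax_l m 1); lra|exact H2].
Qed.

(** * Lower bound for one cube *)

Lemma lossD_delta0 d a s q :
  (0 < d)%nat -> 1 < a ->
  lossD 1 (inner d (fun i => if Nat.eq_dec i 0 then 1 else 0)) (cube d a s q) = 0.
Proof.
  intros Hd Ha. apply cube_lossD_0. intros b. rewrite inner_delta by exact Hd.
  unfold vertex, scales. fold (label b). pose proof (label_sqr b). nra.
Qed.

Lemma cube_sample_complexity_ge d a M eps delta :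
  (1 < d)%nat -> 1 < a -> 0 < M ->
  (forall bs, length bs = (d - 2)%nat -> (forall b, In b bs -> length b = d) ->
    (exists J, interpolates d J bs) ->
    exists w, norm d w <= M /\ w 0%nat = 0 /\
      forall b, In b bs -> inner d w (signs b) = label b) ->
  eps < 1 / 4 -> 0 < delta < 1 / 4 ->
  sample_complexity_ge d eps 1 (cube d a (2 * M) (/ 2 ^ d)) delta (INR d - 1).
Proof.
  intros Hd Ha HM Hsep Heps Hdelta m0 Hok.
  set (P := cube d a (2 * M) (/ 2 ^ d)) in *.
  assert (Hpow : 0 < / 2 ^ d) by (apply Rinv_0_lt_compat, pow_lt; lra).
  assert (HP : nonneg_weights P) by (apply cube_nonneg; lra).
  assert (HP1 : mass P = 1).
  { unfold P. rewrite cube_mass. apply Rinv_r, pow_nonzero. lra. }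
  destruct (Rle_lt_dec (INR d - 1) (INR m0)) as [h|h]; [exact h|exfalso].
  (* A value [m0] below [d - 1] admits sample size [d - 2], the size for which [Hsep] bounds the
     separators. *)
  assert (Hm : (m0 <= d - 2)%nat).
  { assert (m0 < d - 1)%nat; [|lia]. apply INR_lt. rewrite minus_INR by lia. exact h. }
  destruct (MEM_prefer d (fun w => / 2 <= lossD 0 (inner d w) P)) as [A [HA HAb]].
  specialize (Hok A HA _ Hm).
  rewrite (lstar_eq_0 d 1 P (fun i => if Nat.eq_dec i 0 then 1 else 0)) in Hok; auto.
  2:{ rewrite norm_delta0 by lia. lra. }
  2:{ apply lossD_delta0; [lia|exact Ha]. }
  assert (1 / 4 <= l0A d (A 1) P (d - 2) delta); [|lra].
  apply l0A_ge; auto; [lra|].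
  assert (H := expn_interpolates d a (2 * M) (d - 2) nil nil
    (fun S => ind (lossD 0 (inner d (A 1 S)) P >= 1 / 4)) (interpolates_nil d)
    (fun S => proj1 (ind_bounds _))).
  fold P in H.
  apply Rlt_le_trans with (1 - 2 * / 2 ^ d * (2 ^ @length (list bool) nil * (2 ^ (d - 2) - 1))).
  (* The success probability is at least [1 / 2 + / (2 * 2 ^ (d - 2))], well above [delta]. *)
  - replace (2 ^ d) with (4 * 2 ^ (d - 2)).
    + assert (0 < 2 ^ (d - 2)) by (apply pow_lt; lra). simpl length. rewrite pow_O.
      replace (1 - 2 * / (4 * 2 ^ (d - 2)) * (1 * (2 ^ (d - 2) - 1)))
        with (1 / 2 + / (2 * 2 ^ (d - 2))) by (field; lra).
      assert (0 < / (2 * 2 ^ (d - 2))) by (apply Rinv_0_lt_compat; lra). lra.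
    + replace 4 with (2 ^ 2) by ring. rewrite <- pow_add. f_equal. lia.
  - apply H. clear H. intros cs Hl Hc [J HJ]. rewrite ind_true; [lra|].
    apply Rle_ge, Rle_trans with (/ 2); [lra|]. apply HAb; [lra|].
    rewrite rev_append_rev, app_nil_r in HJ.
    destruct (Hsep (rev cs)) as [w [Hw1 [Hw0 Hw]]]; [now rewrite length_rev| |eauto|].
    { intros b Hb. apply Hc, in_rev, Hb. }
    (* Division by [M] brings the separator into the unit ball; the side [2 * M] then turns its
       values into twice the labels, a margin of 2. *)
    exists (fun j => / M * w j). split; [split|].
    + rewrite norm_scal by (left; apply Rinv_0_lt_compat, HM).
      apply (Rmult_le_reg_l M); [exact HM|]. rewrite <- Rmult_assoc, Rinv_r by lra. lra.
    + intros v _. rewrite lossS_eq_0; [apply lossS_nonneg|].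
      intros x y Hxy. apply in_map_iff in Hxy. destruct Hxy as [b [E Hb]].
      injection E as <- <-. rewrite inner_vertex.
      replace (inner d _ (signs b)) with (2 * label b).
      * pose proof (label_sqr b). nra.
      * rewrite <- Hw by (apply in_rev in Hb; exact Hb).
        rewrite <- inner_scal. apply fsum_ext. intros [|j] _; simpl.
        -- rewrite Hw0. ring.
        -- field. lra.
    + apply cube_lossD_ge_half; [lia|]. rewrite Hw0. ring.
Qed.

(** * Upper bound for the mixture *)

(* As [a] is barely above 1, margin 1 along the first axis leaves no norm for the others. *)
Lemma first_axis_dominates d a s s' w b :
  0 <= s' <= s -> 0 < a -> a ^ 2 = 1 + (/ (1 + INR d * s)) ^ 2 ->
  norm (S d) w <= 1 -> 1 < w 0%nat * a -> 0 < label b * inner (S d) w (vertex a s' b).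
Proof.
  intros Hs Ha Ha2 Hw Hwa. apply norm_le_1 in Hw.
  assert (Hd : 0 <= INR d) by apply pos_INR.
  assert (Hds : 0 <= INR d * s) by (apply Rmult_le_pos; lra).
  set (eta := / (1 + INR d * s)) in *.
  assert (Heta : 0 < eta) by (apply Rinv_0_lt_compat; lra).
  (* This identity dictates [eta]: [d] coordinates of size at most [eta] contribute at most
     [1 - eta], less than the margin of the first axis. *)
  assert (Heta1 : eta + eta * (INR d * s) = 1) by (unfold eta; field; lra).
  rewrite inner_succ in Hw.
  assert (Hwj : forall j, In j (seq 0 d) -> Rabs (w (S j)) <= eta).
  { intros j Hj.
    assert (H := fsum_elem_le (fun j => w (S j) * w (S j)) (seq 0 d) j).
    simpl in H. fold (inner d (fun j => w (S j)) (fun j => w (S j))) in H.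
    specialize (H (fun i _ => Rle_0_sqr (w (S i))) Hj).
    (* Hence the squared norm left for the other axes is below [eta ^ 2 / (1 + eta ^ 2)]. *)
    assert (w 0%nat * w 0%nat * (1 + eta ^ 2) > 1) by (rewrite <- Ha2; nra).
    assert (Hsq : w (S j) * w (S j) <= eta * eta) by nra.
    apply Rabs_le. split; nra. }
  assert (Hrest : Rabs (inner d (fun j => w (S j)) (fun j => vertex a s' b (S j))) <=
                  INR d * (eta * s)).
  { unfold inner. eapply Rle_trans; [apply fsum_abs_le|].
    rewrite <- (length_seq d 0) at 2. rewrite <- fsum_const. apply fsum_le. intros j Hj.
    rewrite Rabs_mult. apply Rmult_le_compat; try apply Rabs_pos; [apply Hwj, Hj|].
    unfold vertex, scales, signs. rewrite Rabs_mult, (Rabs_right s') by lra.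
    replace (Rabs (sgn _)) with 1; [lra|].
    destruct (nth (S j) b false); simpl; [rewrite Rabs_right|rewrite Rabs_left]; lra. }
  rewrite inner_succ. unfold vertex at 1. unfold scales. fold (label b).
  set (r := inner d _ (fun j => vertex a s' b (S j))) in *.
  assert (Hr : - (INR d * (eta * s)) <= label b * r).
  { assert (Hl : label b = 1 \/ label b = -1)
      by (unfold label, signs; destruct (nth 0 b false); simpl; auto).
    apply Rabs_le_between in Hrest. destruct Hl as [->| ->]; lra. }
  pose proof (label_sqr b).
  replace (label b * (w 0%nat * (a * label b) + r))
    with (w 0%nat * a * (label b * label b) + label b * r) by ring.
  nra.
Qed.

Lemma half_pow_le_delta delta n :
  0 < delta -> log2 (1 / delta) <= INR n -> (/ 2) ^ n <= delta.
Proof.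
  intros Hdelta H. unfold log2 in H.
  assert (Hl : 0 < ln 2) by (rewrite <- ln_1; apply ln_increasing; lra).
  assert (Hp : 0 < 2 ^ n) by (apply pow_lt; lra).
  apply (Rmult_le_compat_r (ln 2)) in H; [|lra].
  unfold Rdiv in H at 1. rewrite Rmult_assoc, Rinv_l, Rmult_1_r, <- ln_pow in H by lra.
  assert (H1 : 1 / delta <= 2 ^ n).
  { destruct (Rle_lt_dec (1 / delta) (2 ^ n)) as [h|h]; [exact h|].
    apply ln_increasing in h; lra. }
  rewrite pow_inv. apply (Rmult_le_compat_l delta) in H1; [|lra].
  replace (delta * (1 / delta)) with 1 in H1 by (field; lra).
  apply (Rmult_le_reg_r (2 ^ n)); [exact Hp|]. rewrite Rinv_l by lra. exact H1.
Qed.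

Lemma Rceil_ge x : x <= IZR (Rceil x).
Proof.
  unfold Rceil. rewrite opp_IZR. pose proof (base_Int_part (- x)). lra.
Qed.

(** The first basis vector has zero margin loss, so every MEM output has zero empirical loss. One
    flat example then makes its true error 0; missing the flat cube [n] times has probability at
    most [2 ^ (-n)]. *)
Lemma mixture_sample_complexity_le d a s eps delta :
  0 <= s -> 1 < a -> a ^ 2 = 1 + (/ (1 + INR d * s)) ^ 2 ->
  0 < eps -> 0 < delta < 1 ->
  sample_complexity_le (S d) eps 1
    (cube (S d) a 0 (/ 2 ^ S (S d)) ++ cube (S d) a s (/ 2 ^ S (S d)))
    delta (IZR (Rceil (log2 (1 / delta)))).
Proof.
  intros Hs Ha Ha2 Heps Hdelta.
  set (q := / 2 ^ S (S d)).
  assert (Hq : 0 < q) by (apply Rinv_0_lt_compat, pow_lt; lra).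
  assert (Hq2 : 2 ^ S d * q = / 2).
  { unfold q. simpl. field. apply pow_nonzero. lra. }
  set (D := cube (S d) a 0 q ++ cube (S d) a s q).
  assert (HD : nonneg_weights D).
  { intros x y p H. apply in_app_or in H.
    destruct H as [H|H]; apply cube_nonneg in H; lra. }
  assert (HD1 : mass D = 1) by (unfold D; rewrite mass_app, !cube_mass, Hq2; lra).
  assert (Hlog : 0 <= log2 (1 / delta)).
  { assert (1 < 1 / delta).
    { apply (Rmult_lt_reg_r delta); [lra|]. unfold Rdiv. rewrite Rmult_assoc, Rinv_l; lra. }
    unfold log2. apply Rmult_le_pos; left.
    - rewrite <- ln_1. apply ln_increasing; lra.
    - apply Rinv_0_lt_compat. rewrite <- ln_1. apply ln_increasing; lra. }
  assert (Hc := Rceil_ge (log2 (1 / delta))).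
  set (c := Rceil (log2 (1 / delta))) in *.
  (* Nonnegativity ensures that [Z.to_nat] does not truncate the bound. *)
  assert (Hc0 : (0 <= c)%Z) by (apply le_IZR; lra).
  assert (Ec : INR (Z.to_nat c) = IZR c) by (rewrite INR_IZR_INZ, Z2Nat.id; auto).
  exists (Z.to_nat c). split; [|lra].
  intros A HA n Hn.
  rewrite (lstar_eq_0 _ 1 D (fun i => if Nat.eq_dec i 0 then 1 else 0)); auto.
  2:{ rewrite norm_delta0 by lia. lra. }
  2:{ unfold D. rewrite lossD_app, !lossD_delta0 by (lia || lra). lra. }
  rewrite Rminus_0_r. apply l0A_le; [lra|].
  apply Rle_trans with ((/ 2) ^ n).
  2:{ apply half_pow_le_delta; [lra|]. apply le_INR in Hn. lra. }
  rewrite <- Hq2, <- (cube_mass (S d) a s q). apply expn_miss; auto.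
  { intros S. apply ind_bounds. }
  intros S x HS Hx HxS. right. apply ind_false.
  destruct (HA 1 S) as [Hw Hmin]; [lra|].
  specialize (Hmin (fun i => if Nat.eq_dec i 0 then 1 else 0)).
  rewrite norm_delta0 in Hmin by lia. specialize (Hmin (Rle_refl 1)).
  rewrite (lossS_eq_0 1 (inner _ (fun i => if Nat.eq_dec i 0 then 1 else 0))) in Hmin.
  2:{ intros x' y' H'. apply HS in H'. apply in_map_iff in H'.
      destruct H' as [[[x1 y1] p1] [E H']]. simpl in E. injection E as -> ->.
      rewrite inner_delta by lia.
      apply in_app_or in H'. destruct H' as [H'|H'];
        apply in_map_iff in H'; destruct H' as [b [E _]]; injection E as <- <- _;
        unfold vertex, scales; fold (label b); pose proof (label_sqr b); nra. }
  set (w := A 1 S) in *.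
  (* On a flat example the signed prediction is exactly [w 0 * a], and zero empirical loss makes it
     exceed 1. *)
  assert (Hwa : 1 < w 0%nat * a).
  { unfold cube in Hx. rewrite map_map in Hx. apply in_map_iff in Hx.
    destruct Hx as [b [E _]]. simpl in E. subst x.
    assert (H := lossS_le_0 1 _ S _ _ Hmin HxS).
    rewrite inner_succ in H. unfold vertex at 1 in H. unfold scales in H. fold (label b) in H.
    replace (inner d _ _) with 0 in H.
    - pose proof (label_sqr b). nra.
    - symmetry. apply fsum_zero. intros j _. unfold vertex, scales. ring. }
  assert (H0 : lossD 0 (inner (Datatypes.S d) w) D = 0).
  { unfold D. rewrite lossD_app, !cube_lossD_0; [lra| |]; intros b;
      apply (first_axis_dominates d a s); auto; lra. }
  rewrite H0. lra.
Qed.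

(** * Relative sub-Gaussian moments *)

Lemma mixture_subgaussian d a s u :
  subgaussian_rel (cube d a 0 (/ 2 ^ S d) ++ cube d a s (/ 2 ^ S d)) (inner d u) (sqrt 2).
Proof.
  intros t. rewrite pow2_sqrt by lra. rewrite !expectX_app, !cube_expectX_sqr.
  assert (Hp : 0 < / 2 ^ S d) by (apply Rinv_0_lt_compat, pow_lt; lra).
  assert (H0 := cube_expectX_exp d a 0 _ u t (Rlt_le _ _ Hp)).
  assert (Hs := cube_expectX_exp d a s _ u t (Rlt_le _ _ Hp)).
  assert (Hq : 2 ^ d * / 2 ^ S d = / 2) by (simpl; field; apply pow_nonzero; lra).
  rewrite Hq in *.
  set (V0 := inner d _ _) in *. set (Vs := inner d _ _) in Hs |- *.
  assert (HV0 : 0 <= V0) by (apply fsum_nonneg; intros; nra).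
  assert (HVs : 0 <= Vs) by (apply fsum_nonneg; intros; nra).
  assert (Ht : 0 <= t ^ 2) by nra.
  (* Origin of [sqrt 2]: each component has variance proxy at most [V0 + Vs], twice the second
     moment of the mixture. *)
  assert (Hmono : forall V, V <= V0 + Vs ->
    exp (t ^ 2 * V / 2) <= exp (t ^ 2 * 2 * (/ 2 * V0 + / 2 * Vs) / 2)).
  { intros V HV. assert (H : t ^ 2 * V / 2 <= t ^ 2 * 2 * (/ 2 * V0 + / 2 * Vs) / 2) by nra.
    destruct H as [H|H]; [left; apply exp_increasing, H|right; f_equal; exact H]. }
  assert (H1 := Hmono V0 ltac:(lra)). assert (H2 := Hmono Vs ltac:(lra)). lra.
Qed.

(** For a single cube the proxy equals the second moment, so relative moment 1 holds and is weakened
    to [sqrt 2]. *)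
Lemma cube_subgaussian d a s u :
  subgaussian_rel (cube d a s (/ 2 ^ d)) (inner d u) (sqrt 2).
Proof.
  intros t. rewrite pow2_sqrt by lra. rewrite cube_expectX_sqr.
  assert (Hp : 0 < / 2 ^ d) by (apply Rinv_0_lt_compat, pow_lt; lra).
  assert (H := cube_expectX_exp d a s _ u t (Rlt_le _ _ Hp)).
  rewrite Rinv_r in * by (apply pow_nonzero; lra).
  set (V := inner d _ _) in *.
  assert (HV : 0 <= V) by (apply fsum_nonneg; intros; nra).
  assert (Ht : 0 <= t ^ 2) by nra.
  rewrite Rmult_1_l in *. eapply Rle_trans; [exact H|].
  assert (H2 : t ^ 2 * V / 2 <= t ^ 2 * 2 * V / 2) by nra.
  destruct H2 as [H2|H2]; [left; apply exp_increasing, H2|right; f_equal; exact H2].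
Qed.

(** * Choice of parameters and conclusion *)

Lemma is_fdist_intro D :
  nonneg_weights D -> mass D = 1 -> (forall x y p, In (x, y, p) D -> y = 1 \/ y = -1) ->
  is_fdist D.
Proof.
  intros HD H1 Hy. split; [|exact H1]. apply Forall_forall. intros [[x y] p] H.
  split; eauto.
Qed.

Theorem mainTheorem18 :
  exists c C' : R, 0 < c /\ 0 <= C' /\
  forall d : nat, (1 < d)%nat ->
  exists D P : fdist,
    is_fdist D /\ is_fdist P /\
    (forall i j, (i < d)%nat -> (j < d)%nat -> cov D i j = cov P i j) /\
    (forall eps delta : R, 0 < eps < 1/4 -> 0 < delta < 1/4 ->
       sample_complexity_ge d eps 1 P delta (c * INR d - C') /\
       sample_complexity_le d eps 1 D delta (IZR (Rceil (log2 (1 / delta))))) /\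
    (forall u : point, subgaussian_rel D (inner d u) (sqrt 2)) /\
    (forall u : point, subgaussian_rel P (inner d u) (sqrt 2)).
Proof.
  exists 1, 1. split; [lra|split; [lra|]]. intros d Hd.
  (* The constants are chosen in the order [M], [s], [eta], [a]: [M] does not involve [a], which may
     therefore be taken close to 1 afterwards. *)
  destruct (separator_bound d (d - 2)) as [M [HM Hsep]].
  assert (Hr2 : 0 < sqrt 2) by (apply sqrt_lt_R0; lra).
  set (s := sqrt 2 * (2 * M)).
  assert (Hs : 0 < s) by (apply Rmult_lt_0_compat; lra).
  assert (Hs2 : s ^ 2 = 2 * (2 * M) ^ 2).
  { unfold s. rewrite Rpow_mult_distr, pow2_sqrt by lra. reflexivity. }
  (* [d - 1] counts the axes other than the first. *)
  set (eta := / (1 + INR (d - 1) * s)).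
  assert (Heta : 0 < eta).
  { apply Rinv_0_lt_compat. pose proof (pos_INR (d - 1)). nra. }
  set (a := sqrt (1 + eta ^ 2)).
  assert (Ha2 : a ^ 2 = 1 + eta ^ 2) by (apply pow2_sqrt; nra).
  assert (Ha : 1 < a).
  { unfold a. rewrite <- sqrt_1 at 1. apply sqrt_lt_1_alt. nra. }
  assert (Hq : 0 < / 2 ^ d) by (apply Rinv_0_lt_compat, pow_lt; lra).
  assert (Hq' : 0 < / 2 ^ S d) by (apply Rinv_0_lt_compat, pow_lt; lra).
  assert (Eq : 2 ^ d * / 2 ^ d = 1) by (apply Rinv_r, pow_nonzero; lra).
  assert (Eq' : 2 ^ d * / 2 ^ S d = / 2) by (simpl; field; apply pow_nonzero; lra).
  exists (cube d a 0 (/ 2 ^ S d) ++ cube d a s (/ 2 ^ S d)), (cube d a (2 * M) (/ 2 ^ d)).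
  split; [|split; [|split; [|split; [intros eps delta He Hdelta; split|split]]]].
  - apply is_fdist_intro.
    + intros x y p H. apply in_app_or in H. destruct H as [H|H]; apply cube_nonneg in H; lra.
    + rewrite mass_app, !cube_mass, Eq'. lra.
    + intros x y p H. apply in_app_or in H. destruct H as [H|H]; apply cube_labels in H; exact H.
  - apply is_fdist_intro.
    + apply cube_nonneg. lra.
    + rewrite cube_mass. exact Eq.
    + apply cube_labels.
  - intros i j Hi Hj. unfold cov.
    rewrite !expectX_app, !cube_expectX_coord, !cube_expectX_prod, Eq, Eq' by assumption.
    (* On the diagonal, both halves of [D] give [a ^ 2 / 2] on the first axis; elsewhere the flat
       half gives 0 and the other [s ^ 2 / 2 = (2 * M) ^ 2]. *)
    destruct Nat.eq_dec; [|ring]. destruct i as [|i]; simpl scales; rewrite ?Hs2; field.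
  - rewrite Rmult_1_l. apply cube_sample_complexity_ge; auto; lra.
  - destruct d as [|d]; [lia|].
    apply mixture_sample_complexity_le; try lra.
    rewrite Ha2. unfold eta. replace (S d - 1)%nat with d by lia. reflexivity.
  - intros u. apply mixture_subgaussian.
  - intros u. apply cube_subgaussian.
Qed.
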